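(* For every positive integer $m$, the orbit Cayley graph $Cay(Z_2^{4m},S_0\cup S_1)$ is strongly regular with parameters $$\left(2^{4m},\;2^{4m-1}+(-1)^m2^{2m-1}-1,\;2^{4m-2}+(-1)^m2^{2m-1}-2,\;2^{4m-2}+(-1)^m2^{2m-1}\right).$$
   Context: $Z_2^n$ is the elementary abelian $2$-group of rank $n$, viewed as the vector space $F_2^n$; here $n=4m$. For $v\in Z_2^n$, $|v|$ is the number of coordinates equal to $1$, and $O_i=\{v\in Z_2^n : |v|=i\}$ for $0\le i\le n$. Set $S_0=\bigcup_{i\neq 0,\ i\equiv 0 \,(\mathrm{mod}\ 4)}O_i$ and, for $a\in\{1,2,3\}$, $S_a=\bigcup_{i\equiv a\,(\mathrm{mod}\ 4)}O_i$, with $0\le i\le n$. For a group $G$ and $S\subseteq G$ with $1\notin S$ and $S=S^{-1}$, the Cayley graph $Cay(G,S)$ has vertex set $G$, with $x,y$ adjacent iff $x^{-1}y\in S$; it is called an orbit Cayley graph over $Z_2^n$ if $G=Z_2^n$ and $S$ is a union of some of the $O_i$. A strongly regular graph with parameters $(N,r,\lambda,\mu)$ is a connected $r$-regular graph on $N$ vertices in which any two adjacent vertices have exactly $\lambda$ common neighbours and any two distinct non-adjacent vertices have exactly $\mu$ common neighbours. *)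

(* Defs.v *)
From mathcomp Require Import all_boot all_fingroup all_algebra.
Set Implicit Arguments.
Unset Strict Implicit.
Unset Printing Implicit Defensive.

Definition connection_set (gT : finGroupType) (S : {set gT}) : Prop :=
  (1%g \notin S) /\ (S^-1%g = S).

Definition Cay (gT : finGroupType) (S : {set gT}) : rel gT :=
  fun x y => (x^-1 * y)%g \in S.

(* The parameters are integers, so that formulas involving subtraction and
   signs can be used without truncation. *)
Definition strongly_regular (T : finType) (e : rel T)
    (N r lambda mu : int) : Prop :=
  [/\ symmetric e /\ irreflexive e,
      forall x y : T, connect e x y,
      (#|T|%:Z = N)%R,
      forall x : T, (#|[set y | e x y]|%:Z = r)%R
    & (forall x y : T, e x y ->
         (#|[set z | e x z & e y z]|%:Z = lambda)%R) /\
      (forall x y : T, x != y -> ~~ e x y ->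
         (#|[set z | e x z & e y z]|%:Z = mu)%R)].

(* Z_2^n is 'rV['F_2]_n, whose finGroupType structure is the additive one:
   (x * y)%g is x + y, x^-1%g is - x and 1%g is 0 (see FinRing.zmodMgE). *)
Definition weight (n : nat) (v : 'rV['F_2]_n) : nat :=
  #|[set i : 'I_n | v ord0 i == 1%R]|.

Definition O_ (n i : nat) : {set 'rV['F_2]_n} := [set v | weight v == i].

(* The index 0 is excluded explicitly; this matters only for a = 0. *)
Definition S_ (n a : nat) : {set 'rV['F_2]_n} :=
  \bigcup_(i < n.+1 | (i != 0 :> nat) && (i == a %[mod 4])) O_ n i.

Definition orbit_union (n : nat) (S : {set 'rV['F_2]_n}) : Prop :=
  exists I : {set 'I_n.+1}, S = \bigcup_(i in I) O_ n i.

Definition orbit_connection_set (n : nat) (S : {set 'rV['F_2]_n}) : Prop :=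
  connection_set S /\ orbit_union S.

(* Main.v *)
Require Import Defs.
From mathcomp Require Import all_boot all_fingroup all_algebra.
From mathcomp Require Import all_order zify ring.

(** Adding the zero vector to [S_0 :|: S_1] gives the set of the [v] with [|v|]
    equal to 0 or 1 mod 4, that is with [|v| * (|v| - 1) / 2] even.  Over F_2
    this binomial coefficient is the quadratic form
    [Q v = \sum_(i < j) v_i v_j], so the set is the quadric [Q = 0]
    ([quadric], [S01_quadric]), and the graph is the affine polar graph of [Q].

    Everything is read off from the sign [f = (-1)^Q] ([wsign]), since twice
    the indicator function of the quadric is [1 + f]:
    - [f] is bent: the sum of [f z * f (z + g)] over [z] is 0 for every
      [g != 0] ([sum_wsign_shift]).  This is the nondegeneracy of the polar
      form of [Q] in even dimension: a coordinate [i] can be chosen whose flip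
      in [z] changes the sign of every term.
    - the sum of [f] is [(-4)^m] in dimension [4m] ([sum_wsign]).  This is
      [(1 + i)^(4m)] in disguise, as [f v] is the sum of the real and imaginary
      parts of [i^|v|]; adding one coordinate at a time avoids complex numbers.

    Expanding products of indicator functions gives the size of the quadric and
    of its intersection with any translate by [g != 0]: half of
    [2^(4m) + (-4)^m] and a quarter of [2^(4m) + 2 * (-4)^m].  The degree is the
    first number minus 1.  Common neighbours of [x] and [y] are counted by the
    second with [g = x + y], minus the two points 0 and [g] when [g] is on the
    quadric, i.e. when [x] and [y] are adjacent ([card_quadricD10I]).  As
    nonadjacent vertices have common neighbours, the graph has diameter at
    most 2, hence is connected. *)

Set Implicit Arguments.
Unset Strict Implicit.
Unset Printing Implicit Defensive.

Import Order.TTheory GRing.Theory Num.Theory.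
Local Open Scope ring_scope.

(** * Vectors over F_2 and their weights *)

Lemma F2_cases (a : 'F_2) : a = 0 \/ a = 1.
Proof. by case: a => [[|[|k]] hk] //; [left | right]; apply/val_inj. Qed.

Lemma F2_eq1D (a b : 'F_2) : (a + b == 1) = (a == 1) (+) (b == 1).
Proof. by case: (F2_cases a) => ->; case: (F2_cases b) => ->. Qed.

Lemma addvv n (v : 'rV['F_2]_n) : v + v = 0.
Proof.
apply/rowP => i; rewrite !mxE.
by case: (F2_cases (v 0 i)) => ->; apply/val_inj.
Qed.

Lemma oppv n (v : 'rV['F_2]_n) : - v = v.
Proof. by apply/eqP; rewrite eq_sym -subr_eq0 opprK addvv. Qed.

Lemma weightE n (v : 'rV['F_2]_n) : weight v = (\sum_i (v ord0 i == 1%R))%N.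
Proof.
rewrite /weight -sum1dep_card big_mkcond.
by apply: eq_bigr => i _; case: eqP.
Qed.

Lemma weight_eq0 n (v : 'rV['F_2]_n) : (weight v == 0%N) = (v == 0).
Proof.
rewrite cards_eq0; apply/eqP/eqP => [/setP v0 | ->].
  apply/rowP => i; have := v0 i; rewrite !inE mxE.
  by case: (F2_cases (v ord0 i)) => ->.
by apply/setP => i; rewrite !inE mxE.
Qed.

Lemma weight_le n (v : 'rV['F_2]_n) : (weight v <= n)%N.
Proof. by rewrite -[X in (_ <= X)%N](card_ord n) max_card. Qed.

Lemma odd_weightD n (u v : 'rV['F_2]_n) :
  odd (weight (u + v)) = odd (weight u) (+) odd (weight v).
Proof.
rewrite !weightE -oddD -big_split /=.
elim/big_rec2: _ => // i p q _ pq; rewrite !oddD pq mxE F2_eq1D.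
by rewrite !oddb.
Qed.

Lemma weight_row_mx n (a : 'F_2) (v : 'rV['F_2]_n) :
  weight (row_mx a%:M v : 'rV_(1 + n)) = ((a == 1%R) + weight v)%N.
Proof.
rewrite !weightE big_split_ord /= big_ord1 row_mxEl mxE eqxx mulr1n.
by congr (_ + _)%N; apply: eq_bigr => i _; rewrite row_mxEr.
Qed.

(** The weight goes up by 1 if [v_i = 0] and down by 1 if [v_i = 1]; adding the
    decrease on the left avoids truncated subtraction. *)
Lemma weight_flip n (v : 'rV['F_2]_n) i :
  (weight (v + delta_mx ord0 i) + (v ord0 i == 1%R) =
   weight v + (v ord0 i != 1%R))%N.
Proof.
rewrite !weightE (bigD1 i) //= [in RHS](bigD1 i) //=.
have -> : (\sum_(j < n | j != i) ((v + delta_mx ord0 i)%R ord0 j == 1%R) =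
           \sum_(j < n | j != i) (v ord0 j == 1%R))%N.
  by apply: eq_bigr => j ji; rewrite !mxE eqxx (negPf ji) addr0.
rewrite mxE F2_eq1D mxE !eqxx.
by case: (v ord0 i == 1); rewrite /= addn0 add0n addnC.
Qed.

(** * The sign of the quadratic form *)

(** The parity of [k./2] is that of [k * (k - 1) / 2]: both have period 4 in [k],
    with values 0, 0, 1, 1. *)
Definition qsign (k : nat) : int := (-1) ^+ k./2.

Lemma qsignSS k : qsign k.+2 = - qsign k.
Proof. by rewrite /qsign /= exprS mulN1r. Qed.

Lemma qsignS k : qsign k.+1 = (-1) ^+ k * qsign k.
Proof.
rewrite /qsign /= uphalf_half exprD -[X in (-1) ^+ X * _ = _]/(nat_of_bool _).
by rewrite signr_odd.
Qed.

Definition wsign n (v : 'rV['F_2]_n) : int := qsign (weight v).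

(** The exponent is the polar form of [Q] at [v] and the [i]-th unit vector
    [e_i]: [Q (v + e_i) - Q v] is the sum of the coordinates of [v] other than
    the [i]-th, i.e. [|v| + v_i] mod 2. *)
Lemma wsign_flip n (v : 'rV['F_2]_n) i :
  wsign (v + delta_mx ord0 i) =
  (-1) ^+ (odd (weight v) (+) (v ord0 i == 1)) * wsign v.
Proof.
have := weight_flip v i; rewrite /wsign.
case: (v ord0 i == 1); rewrite /= addn0 addn1.
  move=> <-.
  by rewrite /= qsignS addbT negbK mulrA signr_odd -expr2 sqrr_sign mul1r.
by move=> ->; rewrite qsignS addbF signr_odd.
Qed.

(** * Character sums of the sign *)

Lemma sum_rV_recl n (F : 'rV['F_2]_n.+1 -> int) :
  \sum_v F v =
  \sum_(v : 'rV['F_2]_n)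
     (F (row_mx 0%:M v : 'rV_(1 + n)) + F (row_mx 1%:M v : 'rV_(1 + n))).
Proof.
pose h (p : 'F_2 * 'rV['F_2]_n) : 'rV_(1 + n) := row_mx p.1%:M p.2.
rewrite (reindex (h : _ -> 'rV_n.+1)) /=; last first.
  exists (fun v : 'rV_(1 + n) => (lsubmx v 0 0, rsubmx v)) => [[a v] | v] _.
    by rewrite /h row_mxKl row_mxKr mxE eqxx mulr1n.
  by rewrite /h /= -mx11_scalar hsubmxK.
rewrite -(pair_big predT predT (fun a v => F (h (a, v)))) /= exchange_big /=.
apply: eq_bigr => v _; rewrite (bigD1 0) //= (bigD1 1) //= big1 ?addr0 //.
by move=> a; case: (F2_cases a) => ->.
Qed.

Lemma sum_qsignS n r :
  \sum_(v : 'rV['F_2]_n.+1) qsign (weight v + r) =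
  \sum_(v : 'rV['F_2]_n) qsign (weight v + r) +
  \sum_(v : 'rV['F_2]_n) qsign (weight v + r.+1).
Proof.
rewrite sum_rV_recl -big_split; apply: eq_bigr => v _ /=.
by rewrite !weight_row_mx /= add0n add1n addSnnS.
Qed.

Lemma sum_qsign_shift2 n r :
  \sum_(v : 'rV['F_2]_n) qsign (weight v + r.+2) =
  - \sum_(v : 'rV['F_2]_n) qsign (weight v + r).
Proof. by rewrite -sumrN; apply: eq_bigr => v _; rewrite !addnS qsignSS. Qed.

(** With the weights shifted by [r], the sum [G n r] of signs satisfies
    [G (n + 1) r = G n r + G n (r + 1)] by splitting off one coordinate and
    [G n (r + 2) = - G n r].  Hence [G (n + 2) r = 2 G n (r + 1)] and
    [G (n + 4) r = - 4 G n r].  The induction needs the shift [r], although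
    only [r = 0] is wanted. *)
Lemma sum_wsign m : \sum_(v : 'rV['F_2]_(4 * m)) wsign v = (-4) ^+ m.
Proof.
suff G r : \sum_(v : 'rV['F_2]_(4 * m)) qsign (weight v + r) =
           (-4) ^+ m * qsign r.
  by have := G 0%N; rewrite mulr1 => <-; apply: eq_bigr => v _; rewrite addn0.
elim: m r => [|m IH] r.
  rewrite mul1r (bigD1 (0 : 'rV_0)) //= big1 ?addr0.
    by have /eqP -> : weight (0 : 'rV['F_2]_(4 * 0)) == 0%N by rewrite weight_eq0.
  by move=> v /eqP []; apply/rowP => - [].
rewrite mulnS !addSn add0n !sum_qsignS !sum_qsign_shift2 exprS -mulrA -IH.
ring.
Qed.

(** Flipping coordinate [i] in [z] multiplies [f z * f (z + g)] by
    [(-1)^(|g| + g_i)], so the sum equals its opposite as soon as some [i] has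
    [|g| + g_i] odd.  If there were none, [g] would be the zero vector ([|g|]
    even) or the all-one vector ([|g|] odd), the latter being impossible as its
    weight [n] is even. *)
Lemma sum_wsign_shift n (g : 'rV['F_2]_n) :
  ~~ odd n -> g != 0 -> \sum_z wsign z * wsign (z + g) = 0.
Proof.
move=> n_even g0.
have [i gi] : exists i, odd (weight g) (+) (g ord0 i == 1).
  apply/existsP; apply: contraT => /existsPn noi; move: g0.
  case og: (odd (weight g)) noi => noi.
    suff wg : weight g = n by rewrite wg (negPf n_even) in og.
    rewrite /weight -[RHS](card_ord n) -cardsT; congr #|pred_of_set _|.
    by apply/setP => j; rewrite !inE; have := noi j; rewrite addTb negbK.
  rewrite -weight_eq0 cards_eq0 => /negP[]; apply/eqP/setP => j; rewrite !inE.
  by apply/negbTE; have := noi j; rewrite addFb.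
set T := \sum_z _; suff: T = - T by lia.
rewrite {1}/T (reindex_inj (addIr (delta_mx ord0 i))) -sumrN /=.
apply: eq_bigr => z _; rewrite addrAC !wsign_flip odd_weightD mxE F2_eq1D.
move: gi; case: (odd (weight g)); case: (g ord0 i == 1) => //= _;
  case: (odd (weight z)); case: (z ord0 i == 1) => /=; ring.
Qed.

(** * The quadric and its translates *)

Definition quadric n : {set 'rV['F_2]_n} := [set v | ~~ odd (weight v)./2].

Lemma mem_quadricE n (v : 'rV['F_2]_n) :
  2 * (v \in quadric n)%:Z = 1 + wsign v.
Proof. by rewrite inE /wsign /qsign -signr_odd; case: odd. Qed.

Lemma quadric0 n : 0 \in quadric n.
Proof.
by have /eqP w0 : weight (0 : 'rV['F_2]_n) == 0%N;
   rewrite ?weight_eq0 // inE w0.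
Qed.

Lemma card_sumZ (T : finType) (A : {set T}) : #|A|%:Z = \sum_x (x \in A)%:Z.
Proof.
rewrite -sum1_card big_mkcond (big_morph _ PoszD (erefl 0%:Z)).
by apply: eq_bigr => x _; case: ifP.
Qed.

Lemma card_rV_F2 n : #|{: 'rV['F_2]_n}| = (2 ^ n)%N.
Proof. by rewrite card_mx card_Fp // mul1n. Qed.

Lemma sum1_rV_F2 n : \sum_(v : 'rV['F_2]_n) (1 : int) = 2 ^+ n.
Proof. by rewrite sumr_const card_rV_F2 natrX. Qed.

Lemma card_quadric m :
  2 * #|quadric (4 * m)|%:Z = 2 ^+ (4 * m) + (-4) ^+ m.
Proof.
rewrite card_sumZ mulr_sumr -sum1_rV_F2 -sum_wsign -big_split /=.
by apply: eq_bigr => v _; rewrite mem_quadricE.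
Qed.

Lemma card_quadricI m (g : 'rV['F_2]_(4 * m)) : g != 0 ->
  4 * #|[set z in quadric (4 * m) | z + g \in quadric (4 * m)]|%:Z
  = 2 ^+ (4 * m) + 2 * (-4) ^+ m.
Proof.
move=> g0; rewrite card_sumZ mulr_sumr.
have n_even : ~~ odd (4 * m) by rewrite oddM.
pose D := quadric (4 * m).
(* 4 times the product of two indicators is (1 + f z) * (1 + f (z + g)). *)
transitivity (\sum_z (1 + wsign z + wsign (z + g) + wsign z * wsign (z + g))).
  apply: eq_bigr => z _; rewrite inE -/D.
  have -> : wsign z = 2 * (z \in D)%:Z - 1.
    by rewrite mem_quadricE [1 + _]addrC addrK.
  have -> : wsign (z + g) = 2 * (z + g \in D)%:Z - 1.
    by rewrite mem_quadricE [1 + _]addrC addrK.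
  by case: (z \in D); case: (z + g \in D).
rewrite !big_split /= sum_wsign_shift // sum1_rV_F2 addr0.
have := sum_wsign m; rewrite (reindex_inj (addIr g)) /= => ->.
ring.
Qed.

(** The points that are lost when 0 is removed from the quadric are [z = 0] and
    [z = g]; both are counted on the left exactly when [g] is on the quadric. *)
Lemma card_quadricD10I n (g : 'rV['F_2]_n) : g != 0 ->
  #|[set z in quadric n | z + g \in quadric n]| =
  (2 * (g \in quadric n) +
   #|[set z in quadric n :\ 0%R | (z + g)%R \in quadric n :\ 0%R]|)%N.
Proof.
move=> g0; rewrite (cardsD1 0) (cardsD1 g) addnA mul2n -addnn.
congr (_ + _ + _)%N; last apply: eq_card => z.
- by rewrite inE quadric0 add0r.
- by have := quadric0 n; rewrite !inE g0 addvv => ->; rewrite andbT.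
rewrite !inE -[z + g == 0](inj_eq (addIr g)) -addrA addvv addr0 add0r.
by case: (z == g); case: (z == 0); rewrite /= ?andbF.
Qed.

(** * The Cayley graph *)

Lemma S01_quadric n : S_ n 0 :|: S_ n 1 = quadric n :\ 0.
Proof.
apply/setP => v; rewrite !inE -weight_eq0.
have wn := weight_le v.
have SP a : (v \in S_ n a) = (weight v != 0%N) && (weight v == a %[mod 4]).
  apply/bigcupP/idP => [[i hi] | hv].
    by rewrite inE => /eqP ->.
  by exists (inord (weight v)); rewrite ?inE inordK.
by rewrite !SP -andb_orr; congr (_ && _); lia.
Qed.

Lemma mem_CayS01 n (x y : 'rV['F_2]_n) :
  Cay (S_ n 0 :|: S_ n 1) x y = (x + y \in quadric n :\ 0).
Proof. by rewrite /Cay S01_quadric FinRing.zmodMgE FinRing.zmodVgE oppv. Qed.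

Lemma orbit_connection_set_S01 n :
  orbit_connection_set (S_ n 0 :|: S_ n 1).
Proof.
split; first split.
- by rewrite S01_quadric !inE eqxx.
- by apply/setP => v; rewrite inE FinRing.zmodVgE oppv.
pose I a := [set i : 'I_n.+1 | (i != 0 :> nat) && (i == a %[mod 4])%N].
exists (I 0%N :|: I 1%N); rewrite bigcup_setU.
by congr (_ :|: _); apply: eq_bigl => i; rewrite inE.
Qed.

(** The translation [z |-> x + z] moves [x] to the origin. *)
Lemma card_CayS01_common n (x y : 'rV['F_2]_n) :
  #|[set z | Cay (S_ n 0 :|: S_ n 1) x z & Cay (S_ n 0 :|: S_ n 1) y z]| =
  #|[set z in quadric n :\ 0 | z + (x + y) \in quadric n :\ 0]|.
Proof.
rewrite -[RHS](card_preimset _ (addrI x)); apply: eq_card => z.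
have xzxy : x + z + (x + y) = y + z by rewrite addrACA addvv add0r addrC.
by rewrite !inE !mem_CayS01 !inE xzxy.
Qed.

Theorem theorem6 (m : nat) (hm : (0 < m)%N) :
  orbit_connection_set (S_ (4 * m) 0 :|: S_ (4 * m) 1) /\
  strongly_regular (Cay (S_ (4 * m) 0 :|: S_ (4 * m) 1))
    (2 ^+ (4 * m))%R
    (2 ^+ (4 * m - 1) + (-1) ^+ m * 2 ^+ (2 * m - 1) - 1)%R
    (2 ^+ (4 * m - 2) + (-1) ^+ m * 2 ^+ (2 * m - 1) - 2)%R
    (2 ^+ (4 * m - 2) + (-1) ^+ m * 2 ^+ (2 * m - 1))%R.
Proof.
split; first exact: orbit_connection_set_S01.
set n := (4 * m)%N; set e := Cay _; pose h : int := 2 ^+ (2 * m - 1).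
(* All powers are expressed through 2 ^+ (n - 2) = h * h and h, to reach
   linear arithmetic. *)
have h_gt1 : 1 < h by rewrite exprn_egt1 //; lia.
have N4 : 2 ^+ n = 4 * 2 ^+ (n - 2) :> int.
  by rewrite -[4](_ : 2 ^+ 2 = _) // -exprD; congr (_ ^+ _); rewrite /n; lia.
have N2 : 2 ^+ (n - 1) = 2 * 2 ^+ (n - 2) :> int.
  by rewrite -exprS; congr (_ ^+ _); rewrite /n; lia.
have hh : 2 ^+ (n - 2) = h * h.
  by rewrite -exprD; congr (_ ^+ _); rewrite /n; lia.
have F4 : (-4) ^+ m = 2 * ((-1) ^+ m * h) :> int.
  rewrite -mulN1r exprMn mulrCA -exprS -[4](_ : 2 ^+ 2 = _) // -exprM.
  by congr (_ * _ ^+ _); lia.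
rewrite -/h.
(* lambda and mu at once: the last term removes the points 0 and x + y of the
   quadric when x and y are adjacent. *)
have common x y : x != y ->
    #|[set z | e x z & e y z]|%:Z =
    2 ^+ (n - 2) + (-1) ^+ m * h - 2 * (e x y)%:Z.
  move=> xy; have xy0 : x + y != 0 by rewrite -[y]oppv subr_eq0.
  have := card_quadricI xy0; have := card_quadricD10I xy0.
  rewrite card_CayS01_common /e mem_CayS01 !inE xy0 /= -/n N4 F4.
  move=> ->; rewrite PoszD PoszM.
  move: (Posz #|_|) (Posz (nat_of_bool _)) (2 ^+ _) (_ * h) => c b p s.
  by lia.
have e_irr : irreflexive e by move=> x; rewrite /e mem_CayS01 addvv !inE eqxx.
have mu_gt0 : 0 < h * h + (-1) ^+ m * h.
  by rewrite -signr_odd; case: odd; rewrite /=; nia.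
split.
- by split=> // x y; rewrite /e !mem_CayS01 addrC.
- move=> x y; have [-> | xy] := eqVneq x y; first exact: connect0.
  have [exy | nexy] := boolP (e x y); first exact: connect1.
  have : 0 < #|[set z | e x z & e y z]|%:Z.
    by rewrite common // (negPf nexy) mulr0 subr0 hh.
  rewrite ltz_nat => /card_gt0P[z]; rewrite inE => /andP[exz eyz].
  apply: connect_trans (connect1 exz) (connect1 _).
  by move: eyz; rewrite /e !mem_CayS01 addrC.
- by rewrite -natz card_rV_F2 natrX.
- move=> x.
  have -> : [set y | e x y] = (fun y => x + y) @^-1: (quadric n :\ 0).
    by apply/setP => y; rewrite !inE /e mem_CayS01 !inE.
  rewrite card_preimset; last exact: addrI.
  have := card_quadric m; rewrite (cardsD1 0) quadric0 -/n N4 N2 F4 PoszD.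
  by move: (Posz #|_|) (2 ^+ _) (_ * h) => c p s /=; lia.
split=> x y.
  move=> exy; rewrite common ?exy //.
  by apply: contraTneq exy => ->; rewrite e_irr.
by move=> xy nexy; rewrite common // (negPf nexy) mulr0 subr0.
Qed.
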